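(* For every $n\ge 0$, the monoid $\mathcal{O}_n$ of all order-preserving functions $\{0,\ldots,n-1\}\to\{0,\ldots,n-1\}$ (under composition) is isomorphic to a submonoid of $\mathcal{K}_{2n}$, by an embedding in which, for $0\le i\le n-2$, $p^i$ is represented by $h^{2i+3}\circ h^{2i+2}$ and $q^i$ is represented by $h^{2i+1}\circ h^{2i+2}$.
   Context: For $0\le i\le n-2$, $p^i\in\mathcal{O}_n$ is the function with $p^i(i+1)=i$ and $p^i(j)=j$ for $j\ne i+1$; $q^i\in\mathcal{O}_n$ is the function with $q^i(i)=i+1$ and $q^i(j)=j$ for $j\ne i$. The product $f\circ g$ in $\mathcal{O}_n$ is the function that first applies $g$, then $f$. For a natural number $N$, the monoid $\mathcal{K}_N$ (the monoid of Temperley-Lieb algebras) is presented by generators $h^i$ for $i\in\{1,\ldots,N-1\}$ and a further generator $c$, with unit $\mathbf{1}$ and multiplication $\circ$, subject to the monoid equations and the equations (for all indices for which they are defined): $h^i\circ h^j=h^j\circ h^i$ for $j+1<i$; $h^i\circ h^{i\pm 1}\circ h^i=h^i$; $h^i\circ c=c\circ h^i$; $h^i\circ h^i=c\circ h^i$. *)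

(* Defs.v *)
From HB Require Import structures.
From mathcomp Require Import all_boot generic_quotient boolp zify.

Set Implicit Arguments.
Unset Strict Implicit.
Unset Printing Implicit Defensive.

Import Algebra.
Local Open Scope quotient_scope.
Local Open Scope group_scope.

Record ordmon (n : nat) := OrdMon {
  ordmon_fun :> {ffun 'I_n -> 'I_n};
  ordmon_homo :
    [forall i : 'I_n, forall j : 'I_n, (i <= j) ==> (ordmon_fun i <= ordmon_fun j)] }.

HB.instance Definition _ n := [isSub for @ordmon_fun n].
HB.instance Definition _ n := [Finite of ordmon n by <:].

Lemma ordmonP n (f : ordmon n) : {homo f : i j / i <= j}.
Proof.
by move=> i j; move: (ordmon_homo f) => /forallP/(_ i)/forallP/(_ j)/implyP; apply.
Qed.

Lemma ordmon_ext n (f g : ordmon n) : f =1 g -> f = g.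
Proof. by move=> fg; apply/val_inj/ffunP. Qed.

Fact mk_ordmon_subproof n (f : 'I_n -> 'I_n) :
  {homo f : i j / i <= j} ->
  [forall i : 'I_n, forall j : 'I_n, (i <= j) ==> (finfun f i <= finfun f j)].
Proof.
move=> fP; apply/forallP=> i; apply/forallP=> j; apply/implyP=> ij.
by rewrite !ffunE fP.
Qed.

Definition mk_ordmon n (f : 'I_n -> 'I_n) (fP : {homo f : i j / i <= j}) :
  ordmon n := OrdMon (mk_ordmon_subproof fP).

Lemma mk_ordmonE n (f : 'I_n -> 'I_n) (fP : {homo f : i j / i <= j}) :
  mk_ordmon fP =1 f.
Proof. by move=> i; rewrite ffunE. Qed.

Fact ordmon_mul_subproof n (f g : ordmon n) : {homo f \o g : i j / i <= j}.
Proof. by move=> i j ij; apply/ordmonP/ordmonP. Qed.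

(* f * g applies g first, then f. *)
Definition ordmon_mul n (f g : ordmon n) : ordmon n :=
  mk_ordmon (@ordmon_mul_subproof n f g).

Fact ordmon_one_subproof n : {homo (@id 'I_n) : i j / i <= j}.
Proof. by []. Qed.

Definition ordmon_one n : ordmon n := mk_ordmon (@ordmon_one_subproof n).

Lemma ordmon_mulE n (f g : ordmon n) i : ordmon_mul f g i = f (g i).
Proof. exact: mk_ordmonE. Qed.

Lemma ordmon_oneE n i : ordmon_one n i = i.
Proof. exact: mk_ordmonE. Qed.

Fact ordmon_mulA n : associative (@ordmon_mul n).
Proof. by move=> f g k; apply: ordmon_ext => i; rewrite !ordmon_mulE. Qed.

Fact ordmon_mul1g n : left_id (@ordmon_one n) (@ordmon_mul n).
Proof. by move=> f; apply: ordmon_ext => i; rewrite ordmon_mulE ordmon_oneE. Qed.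

Fact ordmon_mulg1 n : right_id (@ordmon_one n) (@ordmon_mul n).
Proof. by move=> f; apply: ordmon_ext => i; rewrite ordmon_mulE ordmon_oneE. Qed.

HB.instance Definition _ n :=
  isMonoid.Build (ordmon n) (@ordmon_mulA n) (@ordmon_mul1g n) (@ordmon_mulg1 n).

(* When i.+1 < n, the values given to insubd are in range, so its default
   argument j is never returned; for other i, both functions are the identity. *)
Definition pfun n (i : nat) (j : 'I_n) : 'I_n :=
  if j == i.+1 :> nat then insubd j i else j.

Definition qfun n (i : nat) (j : 'I_n) : 'I_n :=
  if j == i :> nat then insubd j i.+1 else j.

Lemma pfunE n i (j : 'I_n) : pfun i j = (if j == i.+1 :> nat then i else j) :> nat.
Proof.
rewrite /pfun; case: eqP => // ji; rewrite val_insubd.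
by have := ltn_ord j; rewrite ji => /ltnW ->.
Qed.

Lemma qfunE n i (j : 'I_n) :
  qfun i j = (if (j == i :> nat) && (i.+1 < n) then i.+1 else j) :> nat.
Proof.
by rewrite /qfun; case: eqP => // ji; rewrite val_insubd /=; case: ifP.
Qed.

Fact pfun_homo n i : {homo @pfun n i : j k / j <= k}.
Proof. by move=> j k; rewrite !pfunE; do 2 case: eqP; lia. Qed.

Fact qfun_homo n i : {homo @qfun n i : j k / j <= k}.
Proof.
move=> j k jk; rewrite !qfunE.
by have := ltn_ord k; do 2 case: eqP => ? //=; case: ifP => ?; lia.
Qed.

Definition pgen n i : ordmon n := mk_ordmon (@pfun_homo n i).
Definition qgen n i : ordmon n := mk_ordmon (@qfun_homo n i).

(* The monoid presented by generators A and relations R : the quotient of the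
   free monoid seq A by the congruence generated by R. *)
Section Presented.
Variables (A : choiceType) (R : seq A -> seq A -> Prop).

Inductive gen_cong : seq A -> seq A -> Prop :=
| gen_cong_rel u v : R u v -> gen_cong u v
| gen_cong_refl u : gen_cong u u
| gen_cong_sym u v : gen_cong u v -> gen_cong v u
| gen_cong_trans u v w : gen_cong u v -> gen_cong v w -> gen_cong u w
| gen_cong_cat u u' v v' :
    gen_cong u u' -> gen_cong v v' -> gen_cong (u ++ v) (u' ++ v').

Definition gen_congb : rel (seq A) := fun u v => `[< gen_cong u v >].

Fact gen_congb_refl : reflexive gen_congb.
Proof. by move=> u; apply/asboolP; apply: gen_cong_refl. Qed.

Fact gen_congb_sym : symmetric gen_congb.
Proof. by move=> u v; apply/asboolP/asboolP; apply: gen_cong_sym. Qed.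

Fact gen_congb_trans : transitive gen_congb.
Proof.
move=> v u w /asboolP uv /asboolP vw; apply/asboolP.
exact: gen_cong_trans uv vw.
Qed.

Canonical gen_cong_equiv :=
  EquivRel gen_congb gen_congb_refl gen_congb_sym gen_congb_trans.

Definition presented := {eq_quot gen_cong_equiv}.

HB.instance Definition _ := Choice.on presented.
HB.instance Definition _ := Quotient.on presented.

Definition word (u : seq A) : presented := \pi_presented u.

Lemma eq_word u v : word u = word v <-> gen_cong u v.
Proof. by split=> [/eqmodP/asboolP|uv] //; apply/eqmodP/asboolP. Qed.

Definition presented_mul (x y : presented) : presented := word (repr x ++ repr y).

Lemma presented_mulE u v : presented_mul (word u) (word v) = word (u ++ v).
Proof. by apply/eq_word/gen_cong_cat; apply/eq_word; rewrite /word reprK. Qed.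

Lemma presentedW (P : presented -> Prop) :
  (forall u, P (word u)) -> forall x, P x.
Proof. by move=> Pw x; rewrite -[x]reprK; apply: Pw. Qed.

Fact presented_mulA : associative presented_mul.
Proof.
elim/presentedW=> u; elim/presentedW=> v; elim/presentedW=> w.
by rewrite !presented_mulE catA.
Qed.

Fact presented_mul1g : left_id (word [::]) presented_mul.
Proof. by elim/presentedW=> u; rewrite presented_mulE. Qed.

Fact presented_mulg1 : right_id (word [::]) presented_mul.
Proof. by elim/presentedW=> u; rewrite presented_mulE cats0. Qed.

HB.instance Definition _ :=
  isMonoid.Build presented presented_mulA presented_mul1g presented_mulg1.

End Presented.

Definition tlidx (N : nat) := {i : nat | 0 < i < N}.

(* Some i is the generator h^i; None is c. *)
Definition tlgen (N : nat) := option (tlidx N).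

Inductive tl_rel (N : nat) : seq (tlgen N) -> seq (tlgen N) -> Prop :=
| tl_rel_comm (i j : tlidx N) : (val j).+1 < val i ->
    tl_rel [:: Some i; Some j] [:: Some j; Some i]
| tl_rel_up (i j : tlidx N) : val j = (val i).+1 ->
    tl_rel [:: Some i; Some j; Some i] [:: Some i]
| tl_rel_down (i j : tlidx N) : (val j).+1 = val i ->
    tl_rel [:: Some i; Some j; Some i] [:: Some i]
| tl_rel_hc (i : tlidx N) :
    tl_rel [:: Some i; None] [:: None; Some i]
| tl_rel_hh (i : tlidx N) :
    tl_rel [:: Some i; Some i] [:: None; Some i].

Definition tlmon (N : nat) := presented (@tl_rel N).

HB.instance Definition _ N := Monoid.on (tlmon N).

(* h^i for 0 < i < N; the unit, as a dummy value, for other i. *)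
Definition tlh N (i : nat) : tlmon N :=
  if (insub i : option (tlidx N)) is Some k then word (@tl_rel N) [:: Some k]
  else 1.

(* Main.v *)
Require Import Defs.
From mathcomp Require Import all_boot zify.

Set Implicit Arguments.
Unset Strict Implicit.
Unset Printing Implicit Defensive.

Import Algebra.
Local Open Scope group_scope.

(** The elements p^i = h^{2i+3} h^{2i+2} and q^i = h^{2i+1} h^{2i+2} of the
    Temperley-Lieb monoid satisfy the relations that the functions p^i and q^i
    satisfy.  Two things must be shown: these relations already force any two
    words that denote the same order-preserving function to be equal, so that an
    embedding is well defined, and no two functions become equal in the
    Temperley-Lieb monoid.

    Well-definedness.  An order-preserving g factors as upper g * lower g, where
    upper g is the pointwise maximum of g with the identity and lower g the
    pointwise minimum ([upper_lower]).  A regressive function a (a x <= x) has a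
    normal form as a word in the p^i: the product, larger x on the left, of the
    runs p^{a x} ... p^{x-1} ([pword], [prod_pword]).  The relations between the
    p^i let these normal forms absorb a further p^i on the right ([plift_pgen]);
    conjugating with the order reversal of {0, ..., n-1} yields the same for the
    q^i and extensive functions.  [lift g] is the product of the q-normal form of
    upper g and the p-normal form of lower g.  In [lift_pgen], multiplying by p^i
    changes the two factors, and the mixed relations between the p^i and the q^i
    account for the change: a q-word followed by the p-normal form of a only
    depends on the values of the q-word on the image of a
    ([qlift_plift_skip]).  Multiplication by q^i then follows by moving q^i to
    the left through the p-word ([lift_factor_qgen]), and since the p^i and q^i
    generate, [lift] is a morphism.

    Injectivity.  The Temperley-Lieb monoid acts by binary relations on
    configurations s of n spins: h^{2i+1} relates configurations which agree
    except possibly at the site i, h^{2i+2} is the identity restricted to the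
    configurations with s i = s (i+1), and c is the identity.  Under this action
    p^i and q^i become the graphs of precomposition with the functions p^i and
    q^i ([mon_rel_p], [mon_rel_q]), hence the image of g becomes the graph of
    precomposition with g ([mon_rel_embed]), and g can be read off from the image
    of the identity configuration. *)

(** * Order-preserving functions through their values on natural numbers *)

Section NatVal.
Variable n : nat.
Implicit Types (f g : ordmon n) (i k : nat) (j : 'I_n).

(** Extending by the identity outside of {0, ..., n-1} leaves monotonicity and
    the two inequalities with the identity intact, and makes all values natural
    numbers, so that equations between functions become linear arithmetic. *)
Definition natval f k : nat := if insub k is Some j then val (f j) else k.

Lemma natvalE f j : natval f j = f j.
Proof. by rewrite /natval valK. Qed.

Lemma natval_out f k : (n <= k)%N -> natval f k = k.
Proof. by move=> nk; rewrite /natval insubF // ltnNge nk. Qed.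

Lemma natval_lt f k : (k < n)%N -> (natval f k < n)%N.
Proof. by move=> kn; rewrite -[k]/(val (Ordinal kn)) natvalE ltn_ord. Qed.

Lemma natval_inj f g : natval f =1 natval g -> f = g.
Proof.
by move=> fg; apply: ordmon_ext => j; apply: val_inj; rewrite /= -!natvalE fg.
Qed.

Lemma natval_homo f : {homo natval f : k l / (k <= l)%N}.
Proof.
move=> k l kl; have [ln|nl] := ltnP l n; last first.
  have [kn|nk] := ltnP k n; last by rewrite !natval_out.
  by rewrite (natval_out f nl) (leq_trans (ltnW (natval_lt f kn))).
have kn := leq_ltn_trans kl ln.
rewrite -[k]/(val (Ordinal kn)) -[l]/(val (Ordinal ln)) !natvalE.
exact: ordmonP.
Qed.

Lemma natval1 k : natval 1 k = k.
Proof.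
have [kn|nk] := ltnP k n; last exact: natval_out.
by rewrite -[k]/(val (Ordinal kn)) natvalE ordmon_oneE.
Qed.

Lemma natvalM f g k : natval (f * g) k = natval f (natval g k).
Proof.
have [kn|nk] := ltnP k n; last by rewrite !natval_out.
by rewrite -[k]/(val (Ordinal kn)) !natvalE ordmon_mulE.
Qed.

Lemma natval_mk (h : 'I_n -> 'I_n) (hP : {homo h : i j / (i <= j)%N})
    (F : nat -> nat) :
  (forall j, h j = F j :> nat) -> (forall k, (n <= k)%N -> F k = k) ->
  natval (mk_ordmon hP) =1 F.
Proof.
move=> hF Fout k; have [kn|nk] := ltnP k n; last by rewrite natval_out ?Fout.
by rewrite -[k]/(val (Ordinal kn)) natvalE mk_ordmonE hF.
Qed.

Lemma natval_pgen i k :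
  natval (pgen n i) k = if (k == i.+1) && (i.+1 < n)%N then i else k.
Proof.
apply: (@natval_mk _ _ (fun k => if (k == i.+1) && (i.+1 < n)%N then i else k)).
  move=> j; rewrite pfunE; case: eqP => //= <-; by rewrite ltn_ord.
by move=> l nl; case: eqP => //= li; case: ifP => //; lia.
Qed.

Lemma natval_qgen i k :
  natval (qgen n i) k = if (k == i) && (i.+1 < n)%N then i.+1 else k.
Proof.
apply: (@natval_mk _ _ (fun k => if (k == i) && (i.+1 < n)%N then i.+1 else k)).
  by move=> j; rewrite qfunE.
by move=> l nl; case: eqP => //= li; case: ifP => //; lia.
Qed.

Definition regressive f := forall k, (natval f k <= k)%N.
Definition extensive f := forall k, (k <= natval f k)%N.

Fact lower_subproof f :
  {homo (fun j => if (f j <= j)%N then f j else j) : i j / (i <= j)%N}.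
Proof.
by move=> i j ij; have := ordmonP f ij; do 2 case: ifP => ?; lia.
Qed.

Definition lower f : ordmon n := mk_ordmon (@lower_subproof f).

Fact upper_subproof f :
  {homo (fun j => if (f j <= j)%N then j else f j) : i j / (i <= j)%N}.
Proof.
by move=> i j ij; have := ordmonP f ij; do 2 case: ifP => ?; lia.
Qed.

Definition upper f : ordmon n := mk_ordmon (@upper_subproof f).

Lemma natval_lower f k : natval (lower f) k = minn (natval f k) k.
Proof.
apply: (@natval_mk _ _ (fun k => minn (natval f k) k)) => [j|l nl].
  by rewrite natvalE; case: ifP => ?; lia.
by rewrite natval_out // minnn.
Qed.

Lemma natval_upper f k : natval (upper f) k = maxn (natval f k) k.
Proof.
apply: (@natval_mk _ _ (fun k => maxn (natval f k) k)) => [j|l nl].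
  by rewrite natvalE; case: ifP => ?; lia.
by rewrite natval_out // maxnn.
Qed.

(** If g x <= x then monotonicity gives g (g x) <= g x, so upper g fixes g x; if
    x < g x then lower g fixes x. *)
Lemma upper_lower f : upper f * lower f = f.
Proof.
apply: natval_inj => k; rewrite natvalM natval_upper natval_lower.
have [fk|kf] := leqP (natval f k) k; last by rewrite maxnC /maxn kf.
by apply/maxn_idPr/natval_homo.
Qed.

End NatVal.

(** * Words in generators of the Catalan monoid *)

(** These are defining relations of the monoid of regressive order-preserving
    functions of {0, ..., n-1} (the Catalan monoid, a quotient of the 0-Hecke
    monoid of the symmetric group), on n - 1 generators. *)
Definition catalan_family (M : monoidType) (n : nat) (p : nat -> M) :=
  [/\ forall i, (i.+1 < n)%N -> p i * p i = p i,
      forall i, (i.+2 < n)%N -> p i * p i.+1 * p i = p i * p i.+1,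
      forall i, (i.+2 < n)%N -> p i.+1 * p i * p i.+1 = p i * p i.+1
    & forall i j, (i.+1 < j)%N -> (j.+1 < n)%N -> p i * p j = p j * p i].

Section Runs.

(** With values a x <= x, the run a x, ..., x - 1 denotes the function that
    collapses the interval from a x to x onto a x. *)
Fixpoint runs (F : nat -> nat) (k : nat) : seq nat :=
  if k is k'.+1 then iota (F k') (k' - F k') ++ runs F k' else [::].

Lemma eq_runs F G k :
  (forall x, (x < k)%N -> F x = G x) -> runs F k = runs G k.
Proof.
elim: k => //= k IHk FG; rewrite FG // IHk // => x xk.
exact/FG/ltnW.
Qed.

Lemma runs_lt F k : all (fun i => i.+1 < k)%N (runs F k).
Proof.
elim: k => //= k /allP IHk; rewrite all_cat; apply/andP; split; apply/allP => i.
  by rewrite mem_iota; lia.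
by move/IHk; lia.
Qed.

Variables (M : monoidType) (n : nat) (p : nat -> M).
Hypothesis pP : catalan_family n p.
Local Notation P w := (\prod_(i <- w) p i).

Lemma commute_word k w :
    (k.+1 < n)%N ->
    all (fun i => (i.+1 < n)%N && ((i.+1 < k) || (k.+1 < i))%N) w ->
  p k * P w = P w * p k.
Proof.
case: pP => _ _ _ pC kn; elim: w => [|i w IHw] /=.
  by rewrite big_nil mul1g mulg1.
case/andP=> /andP[iN ik] wk.
rewrite !big_cons mulgA -[RHS]mulgA -(IHw wk) !mulgA.
by congr (_ * _); case/orP: ik => ik; [rewrite (pC i k) | rewrite (pC k i)].
Qed.

Lemma run_rcons b t : P (iota b t.+1) = P (iota b t) * p (b + t).
Proof. by rewrite -addn1 iotaD big_cat big_seq1. Qed.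

Lemma run_cons b t : P (iota b t.+1) = p b * P (iota b.+1 t).
Proof. by rewrite big_cons. Qed.

(** The collapse of an interval onto its least point is a zero of the monoid of
    words in the letters of that run: this lemma and the next give the right and
    the left half. *)
Lemma run_mulr b t k : (b + t < n)%N -> (b <= k < b + t)%N ->
  P (iota b t) * p k = P (iota b t).
Proof.
case: pP => pp prr _ pC; elim: t => [|t IHt] btn bk; first by lia.
have [-> | kt] := eqVneq k (b + t).
  by rewrite run_rcons -mulgA pp //; lia.
have [kt' | kt'] := ltnP k.+1 (b + t).
  by rewrite run_rcons -mulgA -pC ?mulgA ?IHt //; lia.
case: t IHt btn bk kt kt' => [|t] _ btn bk kt kt'; first by lia.
have -> : k = (b + t)%N by lia.
rewrite !run_rcons -!mulgA addnS; congr (_ * _).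
by rewrite mulgA prr //; lia.
Qed.

Lemma run_mull b t k : (b + t < n)%N -> (b <= k < b + t)%N ->
  p k * P (iota b t) = P (iota b t).
Proof.
case: pP => pp _ prl pC; elim: t b => [|t IHt] b btn bk; first by lia.
have [-> | kb] := eqVneq k b.
  by rewrite run_cons mulgA pp //; lia.
have [bk' | bk'] := ltnP b.+1 k.
  by rewrite run_cons mulgA -pC -?mulgA ?IHt //; lia.
case: t IHt btn bk => [|t] _ btn bk; first by lia.
have -> : k = b.+1 by lia.
by rewrite !run_cons !mulgA prl //; lia.
Qed.

Lemma run_mulr_word b t w : (b + t < n)%N ->
    all (fun k => b <= k < b + t)%N w ->
  P (iota b t) * P w = P (iota b t).
Proof.
move=> btn; elim: w => [|k w IHw] /=; first by rewrite big_nil mulg1.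
by case/andP=> bk wP; rewrite big_cons mulgA run_mulr // IHw.
Qed.

Lemma run_mull_word b t w : (b + t < n)%N ->
    all (fun k => b <= k < b + t)%N w ->
  P w * P (iota b t) = P (iota b t).
Proof.
move=> btn; elim: w => [|k w IHw] /=; first by rewrite big_nil mul1g.
by case/andP=> bk wP; rewrite big_cons -mulgA IHw // run_mull.
Qed.

(** Multiplication on the right by p^i replaces the value at i+1 by the value
    at i.  The letter p^i passes the runs of all x < i, and it lengthens the run
    of i into a run from F i to i.  That longer run absorbs the old run of i+1 on
    its left, and it is also the wanted run of i+1, since it absorbs the run of i
    on its right. *)
Lemma runs_mul (F : nat -> nat) k i :
    {homo F : x y / (x <= y)%N} -> (forall x, F x <= x)%N ->
    (i.+1 < k)%N -> (k <= n)%N ->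
  P (runs F k) * p i = P (runs (fun x => if x == i.+1 then F i else F x) k).
Proof.
move=> Fhomo Freg; elim: k => [|k IHk] // ik kn /=.
rewrite !big_cat /=; have [-> | ik1] := eqVneq k i.+1; last first.
  by rewrite -mulgA IHk //; lia.
rewrite /= !big_cat /= [i == _]ltn_eqF //.
have -> : runs (fun x => if x == i.+1 then F i else F x) i = runs F i.
  by apply: eq_runs => x xi; case: eqP => // xi1; lia.
have Fi := Freg i; have Fi1 := Freg i.+1; have Fii := Fhomo _ _ (leqnSn i).
have iN : (i.+1 < n)%N by lia.
rewrite -!mulgA -commute_word //; last first.
  apply/allP => x /(allP (runs_lt F i)); lia.
have E : P (iota (F i) (i - F i)) * p i = P (iota (F i) (i.+1 - F i)).
  by rewrite subSn // run_rcons subnKC.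
rewrite [_ * (p i * _)]mulgA E !mulgA; congr (_ * _).
rewrite run_mull_word ?run_mulr_word //; try lia.
  apply/allP => x; rewrite mem_iota; lia.
by apply/allP => x; rewrite mem_iota; lia.
Qed.

End Runs.

Section Catalan.
Variable n : nat.
Implicit Types (a b : ordmon n) (i k : nat).

Definition pword a := runs (natval a) n.

Lemma pword_lt a : all (fun i => i.+1 < n)%N (pword a).
Proof. exact: runs_lt. Qed.

Lemma natval_run m t y : (m + t < n)%N ->
  natval (\prod_(i <- iota m t) pgen n i) y =
  if (m <= y <= m + t)%N then m else y.
Proof.
elim: t m => [|t IHt] m mtn.
  by rewrite big_nil natval1; case: ifP; lia.
rewrite big_cons natvalM IHt; last by lia.
rewrite natval_pgen (_ : m.+1 < n)%N ?andbT; last by lia.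
by case: (boolP (_ <= y <= _)%N) => ?; do 2 case: ifP; lia.
Qed.

Lemma natval_runs a k x : regressive a -> (k <= n)%N ->
  natval (\prod_(i <- runs (natval a) k) pgen n i) x =
  if (x < k)%N then natval a x else x.
Proof.
move=> areg; elim: k => [|k IHk] kn /=; first by rewrite big_nil natval1.
have ak := areg k; have ax := areg x.
rewrite big_cat natvalM IHk; last by lia.
rewrite natval_run; last by lia.
have xk : (x <= k -> natval a x <= natval a k)%N by apply: natval_homo.
have [->|xNk] := eqVneq x k; first by rewrite ltnn ltnSn; case: ifP; lia.
have [xltk|kltx] := ltnP x k.
  by rewrite (ltnW xltk : x < k.+1)%N; case: ifP; have := xk (ltnW xltk); lia.
by rewrite (_ : (x < k.+1)%N = false); [case: ifP; lia | lia].
Qed.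

Lemma prod_pword a : regressive a -> \prod_(i <- pword a) pgen n i = a.
Proof.
move=> areg; apply: natval_inj => k; rewrite natval_runs //.
by case: ltnP => // nk; rewrite natval_out.
Qed.

Lemma regressive1 : regressive (1 : ordmon n).
Proof. by move=> k; rewrite natval1. Qed.

Lemma regressiveM a b : regressive a -> regressive b -> regressive (a * b).
Proof. by move=> aP bP k; rewrite natvalM (leq_trans (aP _)). Qed.

Lemma regressive_pgen i : regressive (pgen n i).
Proof. by move=> k; rewrite natval_pgen; case: ifP => //; lia. Qed.

(** The p^i generate the regressive functions, in the form used for inductions. *)
Lemma regressive_ind (S : ordmon n -> Prop) :
    S 1 ->
    (forall a i, regressive a -> (i.+1 < n)%N -> S a -> S (a * pgen n i)) ->
  forall a, regressive a -> S a.
Proof.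
move=> S1 Sp a /prod_pword <-.
elim/last_ind: (pword a) (pword_lt a) => [|w i IHw]; first by rewrite big_nil.
rewrite all_rcons big_rcons /= => /andP[iN wN].
apply: Sp => //; last exact: IHw.
elim: (w) => [|k v IHv]; first by rewrite big_nil; apply: regressive1.
by rewrite big_cons; apply: regressiveM => //; apply: regressive_pgen.
Qed.

Variables (M : monoidType) (p : nat -> M).

Definition plift a : M := \prod_(i <- pword a) p i.

Lemma plift1 : plift 1 = 1.
Proof.
suff E k : \prod_(i <- runs (natval (1 : ordmon n)) k) p i = 1 by apply: E.
elim: k => [|k IHk] /=; first by rewrite big_nil.
by rewrite big_cat /= IHk natval1 subnn big_nil mulg1.
Qed.

Hypothesis pP : catalan_family n p.

Lemma plift_pgen a i : regressive a -> (i.+1 < n)%N ->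
  plift (a * pgen n i) = plift a * p i.
Proof.
move=> areg iN; rewrite /plift /pword (runs_mul pP) //; last exact: natval_homo.
congr (\prod_(j <- _) _); apply: eq_runs => x _.
by rewrite natvalM natval_pgen iN andbT (fun_if (natval a)).
Qed.

Lemma plift_pgenl a i : regressive a -> (i.+1 < n)%N ->
  plift (pgen n i * a) = p i * plift a.
Proof.
move=> areg iN; elim/regressive_ind: a / areg => [|a j areg jN IHa].
  rewrite plift1 !mulg1 -[pgen n i]mul1g plift_pgen ?plift1 ?mul1g //.
  exact: regressive1.
rewrite mulgA !plift_pgen // ?IHa ?mulgA //.
exact: regressiveM (@regressive_pgen i) areg.
Qed.

End Catalan.

(** * The dual Catalan monoid by order reversal *)

Section Reversal.
Variable n : nat.
Implicit Types (f g : ordmon n) (i k : nat).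

Fact flip_subproof f :
  {homo (fun j => rev_ord (f (rev_ord j))) : i j / (i <= j)%N}.
Proof.
move=> i j ij /=; apply: leq_sub2l; rewrite ltnS; apply: ordmonP => /=.
by apply: leq_sub2l.
Qed.

Definition flip f : ordmon n := mk_ordmon (@flip_subproof f).

Lemma flipE f j : flip f j = rev_ord (f (rev_ord j)).
Proof. exact: mk_ordmonE. Qed.

Lemma flipK : involutive flip.
Proof. by move=> f; apply: ordmon_ext => j; rewrite !flipE !rev_ordK. Qed.

Lemma flip1 : flip 1 = 1.
Proof. by apply: ordmon_ext => j; rewrite flipE !ordmon_oneE rev_ordK. Qed.

Lemma flipM f g : flip (f * g) = flip f * flip g.
Proof. by apply: ordmon_ext => j; rewrite !(flipE, ordmon_mulE) rev_ordK. Qed.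

Lemma flip_qgen i : (i.+1 < n)%N -> flip (qgen n i) = pgen n (n - i.+2).
Proof.
move=> iN; apply: ordmon_ext => j; apply: val_inj.
rewrite flipE mk_ordmonE mk_ordmonE /=.
rewrite qfunE pfunE /= iN andbT; have := ltn_ord j.
by do 2 case: eqP; lia.
Qed.

Lemma flip_regressive f : regressive (flip f) <-> extensive f.
Proof.
split=> fP k; have [kn|nk] := ltnP k n; try by rewrite natval_out.
  have := fP (n - k.+1)%N; set j := Ordinal kn.
  rewrite -[(n - k.+1)%N]/(val (rev_ord j)) natvalE flipE rev_ordK -[k]/(val j).
  by rewrite natvalE /=; have := ltn_ord (f j); lia.
set j := Ordinal kn; rewrite -[k]/(val j) natvalE flipE.
have := fP (rev_ord j); have := ltn_ord (f (rev_ord j)).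
by rewrite natvalE /=; lia.
Qed.

End Reversal.

Section DualCatalan.
Variable n : nat.
Implicit Types (b : ordmon n) (i k : nat).

Lemma extensive1 : extensive (1 : ordmon n).
Proof. by move=> k; rewrite natval1. Qed.

Lemma extensive_ind (S : ordmon n -> Prop) :
    S 1 ->
    (forall b i, extensive b -> (i.+1 < n)%N -> S b -> S (b * qgen n i)) ->
  forall b, extensive b -> S b.
Proof.
move=> S1 Sq b /flip_regressive bP; rewrite -[b]flipK.
elim/regressive_ind: (flip b) / bP => [|a i aP iN Sa]; first by rewrite flip1.
have -> : pgen n i = flip (qgen n (n - i.+2)).
  by rewrite flip_qgen; [congr pgen; lia | lia].
rewrite flipM flipK; apply: Sq => //; last by lia.
by apply/flip_regressive; rewrite flipK.
Qed.

Variables (M : monoidType) (q : nat -> M).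

(** Conjugation by the reversal turns q^i into p^{n-2-i}. *)
Definition qlift b : M := plift (fun i => q (n - i.+2)%N) (flip b).

Lemma qlift1 : qlift 1 = 1.
Proof. by rewrite /qlift flip1 plift1. Qed.

Hypothesis qP : catalan_family n (fun i => q (n - i.+2)%N).

Lemma qlift_qgen b i : extensive b -> (i.+1 < n)%N ->
  qlift (b * qgen n i) = qlift b * q i.
Proof.
move=> bP iN; rewrite /qlift flipM flip_qgen // plift_pgen //; last by lia.
- by congr (_ * q _); lia.
- exact/flip_regressive.
Qed.

End DualCatalan.

(** * Extending the assignment of generators to all order-preserving functions *)

Section Lift.
Variables (n : nat) (M : monoidType) (p q : nat -> M).
Hypothesis pP : catalan_family n p.
Hypothesis qP : catalan_family n (fun i => q (n - i.+2)%N).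
Hypothesis pq_same : forall i, (i.+1 < n)%N -> p i * q i = p i.
Hypothesis qp_same : forall i, (i.+1 < n)%N -> q i * p i = q i.
Hypothesis pq_next : forall i, (i.+2 < n)%N -> p i * q i.+1 = q i.+1.
Hypothesis qp_next : forall i, (i.+2 < n)%N -> q i.+1 * p i = p i.
Hypothesis pq_comm : forall i j, (i.+1 < n)%N -> (j.+1 < n)%N ->
  i != j -> i.+1 != j -> p i * q j = q j * p i.
Implicit Types (a b g : ordmon n) (i j k : nat).
Local Notation P := (@plift n M p).
Local Notation Q := (@qlift n M q).

(** A function which misses the value i+1 is left unchanged by p^i. *)
Lemma plift_skip_p a i : regressive a -> (i.+1 < n)%N ->
  (forall k, natval a k != i.+1) -> p i * P a = P a.
Proof.
move=> aP iN ai; rewrite -plift_pgenl //; congr P.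
by apply: natval_inj => k; rewrite natvalM natval_pgen (negPf (ai k)).
Qed.

(** As q^{i+1} also fixes all the other values, it can be absorbed too: write the
    word as p^i times itself and use q^{i+1} p^i = p^i. *)
Lemma plift_skip_q a i : regressive a -> (i.+2 < n)%N ->
  (forall k, natval a k != i.+1) -> q i.+1 * P a = P a.
Proof.
move=> aP iN ai; rewrite -(@plift_skip_p a i) //; last exact: ltnW.
by rewrite mulgA qp_next.
Qed.

(** The value of b at a point i+1 outside of the image of a does not matter:
    insert q^{i+1} between the two factors, and note that b q^{i+1} takes at i+1 the
    value of b at i+2.  At the last point there is nothing to prove, as b and b'
    both fix it. *)
Lemma qlift_plift_skip a b b' i : regressive a -> extensive b -> extensive b' ->
    (i.+1 < n)%N -> (forall k, natval a k != i.+1) ->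
    (forall k, k != i.+1 -> natval b k = natval b' k) ->
  Q b * P a = Q b' * P a.
Proof.
move=> aP bP b'P iN ai bb'.
have [iN2|iN2] := ltnP i.+2 n; last first.
  congr (Q _ * _); apply: natval_inj => k; have [->|/bb' //] := eqVneq k i.+1.
  have := natval_lt b iN; have := natval_lt b' iN.
  by have := bP i.+1; have := b'P i.+1; lia.
rewrite -(@plift_skip_q a i) // !mulgA -!(qlift_qgen qP) //.
congr (Q _ * _); apply: natval_inj => k; rewrite !natvalM natval_qgen iN2 andbT.
by apply: bb'; case: ifP; lia.
Qed.

(** Here b = b q^i, so that q^i p^i = q^i applies. *)
Lemma qlift_flat b i : extensive b -> (i.+1 < n)%N ->
  natval b i = natval b i.+1 -> Q b * p i = Q b.
Proof.
move=> bP iN bi; have E : b = b * qgen n i.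
  apply: natval_inj => k; rewrite natvalM natval_qgen iN andbT.
  by case: eqP => [->|].
by rewrite E qlift_qgen // -mulgA qp_same.
Qed.

Definition lift g : M := Q (upper g) * P (lower g).

Lemma extensive_upper g : extensive (upper g).
Proof. by move=> k; rewrite natval_upper leq_maxr. Qed.

Lemma regressive_lower g : regressive (lower g).
Proof. by move=> k; rewrite natval_lower geq_minr. Qed.

(** With g' = g p^i and a = (lower g) p^i, the word obtained for lift g * p^i is
    that of upper g followed by that of a.  First, upper g is replaced by
    upper g': these differ only at i+1, and if they do differ, then a misses the
    value i+1.  Then a is replaced by lower g': these differ only if g i > i, and
    in that case upper g' takes equal values at i and i+1, so it absorbs a factor
    p^i, and p^i a = p^i (lower g'). *)
Lemma lift_pgen g i : (i.+1 < n)%N -> lift (g * pgen n i) = lift g * p i.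
Proof.
move=> iN; set g' := g * pgen n i; set a := lower g * pgen n i.
have aP : regressive a.
  by apply: regressiveM (@regressive_pgen n i); apply: regressive_lower.
have g'E k : natval g' k = if k == i.+1 then natval g i else natval g k.
  by rewrite natvalM natval_pgen iN andbT; case: eqP.
have aE k : natval a k =
    if k == i.+1 then minn (natval g i) i else minn (natval g k) k.
  by rewrite natvalM natval_pgen iN andbT; case: eqP => _; rewrite natval_lower.
have Pa : P (lower g) * p i = P a.
  by rewrite -plift_pgen //; apply: regressive_lower.
have gi := natval_homo g (leqnSn i).
clearbody a g'; rewrite /lift -mulgA Pa.
have -> : Q (upper g) * P a = Q (upper g') * P a.
  have [E|neq] := eqVneq (natval (upper g) i.+1) (natval (upper g') i.+1).
    congr (Q _ * _); apply: natval_inj => k.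
    have [->//|kN] := eqVneq k i.+1.
    by rewrite !natval_upper g'E (negPf kN).
  apply: (@qlift_plift_skip a _ _ i) => //; try exact: extensive_upper.
    move=> k; rewrite aE; move: neq; rewrite !natval_upper g'E eqxx => neq.
    case: ifP => [_|/eqP ki]; first by lia.
    have [ki'|ki'] := ltnP i.+1 k; last by lia.
    by have := natval_homo g (ltnW ki'); lia.
  by move=> k kN; rewrite !natval_upper g'E (negPf kN).
have [gi'|gi'] := leqP (natval g i) i.
  congr (_ * P _); apply: natval_inj => k; rewrite natval_lower g'E aE.
  by case: eqP => // ->; lia.
have flat : Q (upper g') * p i = Q (upper g').
  apply: qlift_flat => //; first exact: extensive_upper.
  by rewrite !natval_upper !g'E eqxx ltn_eqF //; lia.
have g'P : regressive (lower g') by apply: regressive_lower.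
rewrite -flat -!mulgA -!(plift_pgenl pP) //; congr (_ * P _).
apply: natval_inj => k.
rewrite !natvalM !natval_pgen natval_lower g'E aE iN !andbT.
by case: (eqVneq k i.+1) => [->|//]; do 2 case: eqP; lia.
Qed.

Lemma lift_extensive b : extensive b -> lift b = Q b.
Proof.
move=> bP; rewrite /lift (_ : upper b = b); last first.
  by apply: natval_inj => k; rewrite natval_upper; apply/maxn_idPl.
rewrite (_ : lower b = 1) ?plift1 ?mulg1 //.
by apply: natval_inj => k; rewrite natval_lower natval1; apply/minn_idPr.
Qed.

Lemma lift1 : lift 1 = 1.
Proof. by rewrite lift_extensive ?qlift1 //; apply: extensive1. Qed.

(** Thus the value of a q-word followed by a p-word only depends on the function
    that it denotes, and not on the factorization. *)
Lemma lift_factor b a : extensive b -> regressive a -> lift (b * a) = Q b * P a.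
Proof.
move=> bP; elim/regressive_ind => [|{}a i aP iN IHa].
  by rewrite plift1 !mulg1 lift_extensive.
by rewrite mulgA lift_pgen // IHa plift_pgen // mulgA.
Qed.

Lemma pgen_qgen_same i : pgen n i * qgen n i = pgen n i.
Proof.
apply: natval_inj => k; rewrite natvalM !natval_pgen natval_qgen.
have [iN|iN] := boolP (i.+1 < n)%N; rewrite ?andbT ?andbF //.
by case: (eqVneq k i) => [->|//]; rewrite eqxx ltn_eqF.
Qed.

Lemma pgen_qgen_next i : (i.+2 < n)%N -> pgen n i * qgen n i.+1 = qgen n i.+1.
Proof.
move=> iN; apply: natval_inj => k.
rewrite natvalM natval_pgen !natval_qgen iN (ltnW iN) !andbT.
by case: (eqVneq k i.+1) => [_|kN]; [rewrite gtn_eqF | case: eqP kN].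
Qed.

Lemma pgen_qgen_comm i j : i != j -> i.+1 != j ->
  pgen n i * qgen n j = qgen n j * pgen n i.
Proof.
move=> ij i1j; apply: natval_inj => k.
rewrite !natvalM !natval_pgen !natval_qgen.
have [iN|iN] := boolP (i.+1 < n)%N; have [jN|jN] := boolP (j.+1 < n)%N;
  rewrite ?andbT ?andbF ?if_same //.
have [->|kj] := eqVneq k j; last first.
  by have [_|_] := eqVneq k i.+1; rewrite ?(negPf ij) ?(negPf kj).
rewrite eqSS [j == i]eq_sym (negPf ij) [j == i.+1]eq_sym (negPf i1j).
by rewrite eqxx.
Qed.

(** Moving q^i to the left through the p-word, the relations either let it pass,
    or cancel it against a p^i, or cancel a p^{i-1} against it. *)
Lemma lift_factor_qgen b a i : extensive b -> regressive a -> (i.+1 < n)%N ->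
  lift (b * a * qgen n i) = Q b * P a * q i.
Proof.
move=> bP aP iN; elim/regressive_ind: a / aP => [|a j aP jN IHa].
  rewrite plift1 !mulg1 lift_extensive ?qlift_qgen //.
  move=> k; rewrite natvalM (leq_trans _ (bP _)) //.
  by rewrite natval_qgen; case: ifP => //; lia.
rewrite plift_pgen // -!mulgA.
have [ji|ji] := eqVneq j i.
  rewrite -{}ji pgen_qgen_same pq_same // -plift_pgen // lift_factor //.
  exact: regressiveM (@regressive_pgen n j).
have [ji1|ji1] := eqVneq j.+1 i.
  subst i; rewrite pgen_qgen_next // pq_next // !mulgA.
  exact: IHa.
rewrite pgen_qgen_comm // pq_comm // !mulgA lift_pgen //.
by rewrite -IHa.
Qed.

Lemma lift_qgen g i : (i.+1 < n)%N -> lift (g * qgen n i) = lift g * q i.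
Proof.
move=> iN; rewrite -{1}[g]upper_lower lift_factor_qgen //.
  exact: extensive_upper.
exact: regressive_lower.
Qed.

Lemma ordmon_ind (S : ordmon n -> Prop) :
    S 1 ->
    (forall g i, (i.+1 < n)%N -> S g -> S (g * pgen n i)) ->
    (forall g i, (i.+1 < n)%N -> S g -> S (g * qgen n i)) ->
  forall g, S g.
Proof.
move=> S1 Sp Sq g; rewrite -[g]upper_lower.
elim/regressive_ind: (lower g) / (@regressive_lower g) => [|a i _ iN Sa].
  rewrite mulg1; elim/extensive_ind: (upper g) / (@extensive_upper g) => // b i _.
  exact: Sq.
by rewrite mulgA; apply: Sp.
Qed.

Lemma lift_morphism : monoid_morphism lift.
Proof.
split=> [|g h]; first exact: lift1.
elim/ordmon_ind: h => [|h i iN IHh|h i iN IHh]; first by rewrite lift1 !mulg1.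
  by rewrite mulgA !lift_pgen // IHh -mulgA.
by rewrite mulgA !lift_qgen // IHh -mulgA.
Qed.

End Lift.

(** * Relations between the products of Temperley-Lieb generators *)

Section TLRelations.
Variables (M : monoidType) (n : nat) (h : nat -> M).
Hypothesis h_adj : forall i j, (0 < i < 2 * n)%N -> (0 < j < 2 * n)%N ->
  (j == i.+1) || (i == j.+1) -> h i * h j * h i = h i.
Hypothesis h_far : forall i j, (0 < i < 2 * n)%N -> (0 < j < 2 * n)%N ->
  (i.+1 < j)%N || (j.+1 < i)%N -> h i * h j = h j * h i.

Definition tl_p i := h (2 * i + 3) * h (2 * i + 2).
Definition tl_q i := h (2 * i + 1) * h (2 * i + 2).

(** The relations between adjacent p^i, with a, b, c, d = h^{2i+2}, ..., h^{2i+5},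
    and, with the order of the indices reversed, those between adjacent q^i. *)
Lemma interleave (a b c d : M) : a * b * a = a -> d * c * d = d ->
    a * c = c * a -> a * d = d * a -> b * d = d * b ->
  (b * a) * (d * c) * (b * a) = (b * a) * (d * c) /\
  (d * c) * (b * a) * (d * c) = (b * a) * (d * c).
Proof.
move=> aba dcd ac ad bd; have E : b * a * (d * c) = d * b * c * a.
  by rewrite -mulgA [a * _]mulgA ad -bd -!mulgA ac.
split; first by rewrite E -!mulgA [a * _]mulgA aba.
by rewrite -mulgA E !mulgA dcd.
Qed.

Lemma far_pairs (a b c d : M) : a * c = c * a -> a * d = d * a ->
  b * c = c * b -> b * d = d * b -> (a * b) * (c * d) = (c * d) * (a * b).
Proof.
move=> ac ad bc bd.
by rewrite -mulgA [b * _]mulgA bc -mulgA bd !mulgA ac -[c * a * d]mulgA ad !mulgA.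
Qed.

Lemma absorb_next (a b c : M) : a * b * a = a -> (c * a) * (b * a) = c * a.
Proof. by move=> aba; rewrite -mulgA [a * _]mulgA aba. Qed.

Lemma absorb_prev (a b c : M) : a * b * a = a -> (a * b) * (a * c) = a * c.
Proof. by move=> aba; rewrite mulgA aba. Qed.

Lemma tl_p_catalan : catalan_family n tl_p.
Proof.
have inter i : (i.+2 < n)%N ->
    tl_p i * tl_p i.+1 * tl_p i = tl_p i * tl_p i.+1 /\
    tl_p i.+1 * tl_p i * tl_p i.+1 = tl_p i * tl_p i.+1.
  by move=> iN; apply: interleave; do ?[apply: h_adj | apply: h_far]; lia.
split=> [i iN|i /inter[]|i /inter[]|i j ij jN] //.
  by apply: absorb_next; apply: h_adj; lia.
by apply: far_pairs; apply: h_far; lia.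
Qed.

Lemma tl_q_catalan : catalan_family n (fun i => tl_q (n - i.+2)%N).
Proof.
have inter i : (i.+2 < n)%N ->
    tl_q i.+1 * tl_q i * tl_q i.+1 = tl_q i.+1 * tl_q i /\
    tl_q i * tl_q i.+1 * tl_q i = tl_q i.+1 * tl_q i.
  by move=> iN; apply: interleave; do ?[apply: h_adj | apply: h_far]; lia.
have S i : (i.+2 < n)%N -> (n - i.+2 = (n - i.+3).+1)%N by lia.
split=> [i iN|i iN|i iN|i j ij jN].
- by apply: absorb_next; apply: h_adj; lia.
- by rewrite (S i iN); have [] := inter (n - i.+3)%N; first lia.
- by rewrite (S i iN); have [] := inter (n - i.+3)%N; first lia.
by apply: far_pairs; apply: h_far; lia.
Qed.

Lemma tl_pq_same i : (i.+1 < n)%N -> tl_p i * tl_q i = tl_p i.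
Proof. by move=> iN; apply: absorb_next; apply: h_adj; lia. Qed.

Lemma tl_qp_same i : (i.+1 < n)%N -> tl_q i * tl_p i = tl_q i.
Proof. by move=> iN; apply: absorb_next; apply: h_adj; lia. Qed.

Lemma tl_pq_next i : (i.+2 < n)%N -> tl_p i * tl_q i.+1 = tl_q i.+1.
Proof.
move=> iN; rewrite /tl_p /tl_q (_ : 2 * i.+1 + 1 = 2 * i + 3)%N; last by lia.
by apply: absorb_prev; apply: h_adj; lia.
Qed.

Lemma tl_qp_next i : (i.+2 < n)%N -> tl_q i.+1 * tl_p i = tl_p i.
Proof.
move=> iN; rewrite /tl_p /tl_q (_ : 2 * i.+1 + 1 = 2 * i + 3)%N; last by lia.
by apply: absorb_prev; apply: h_adj; lia.
Qed.

Lemma tl_pq_comm i j : (i.+1 < n)%N -> (j.+1 < n)%N ->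
  i != j -> i.+1 != j -> tl_p i * tl_q j = tl_q j * tl_p i.
Proof. by move=> iN jN ij i1j; apply: far_pairs; apply: h_far; lia. Qed.

End TLRelations.

(** * The Temperley-Lieb generators *)

Section TLGenerators.
Variable n : nat.
Local Notation N := (2 * n)%N.
Local Notation h := (tlh N).

Lemma tlhE k (kN : (0 < k < N)%N) :
  h k = word (@tl_rel N) [:: Some (exist (fun i => 0 < i < N)%N k kN)].
Proof. by rewrite /tlh insubT. Qed.

Lemma wordM u v :
  word (@tl_rel N) u * word (@tl_rel N) v = word (@tl_rel N) (u ++ v).
Proof. exact: presented_mulE. Qed.

Lemma tlh_adj i j : (0 < i < N)%N -> (0 < j < N)%N ->
  (j == i.+1) || (i == j.+1) -> h i * h j * h i = h i.
Proof.
move=> iN jN ij; rewrite !tlhE (wordM [:: _] [:: _]) (wordM [:: _; _] [:: _]).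
apply/eq_word/gen_cong_rel.
case/orP: ij => /eqP ij; first exact: tl_rel_up.
exact: tl_rel_down.
Qed.

Lemma tlh_far i j : (0 < i < N)%N -> (0 < j < N)%N ->
  (i.+1 < j)%N || (j.+1 < i)%N -> h i * h j = h j * h i.
Proof.
move=> iN jN; wlog ij : i j iN jN / (j.+1 < i)%N => [W|_].
  by case/orP=> ij; [symmetry|]; apply: W; rewrite ?ij ?orbT.
rewrite !tlhE !(wordM [:: _] [:: _]).
exact/eq_word/gen_cong_rel/tl_rel_comm.
Qed.

End TLGenerators.

(** * An action on spin configurations *)

Section Spins.
Variable n : nat.
Local Notation N := (2 * n)%N.
Local Notation spins := {ffun 'I_n -> 'I_n}.
Implicit Types (s t r : spins) (a b k : nat).

(** The two families of generators of the Potts representation of the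
    Temperley-Lieb algebra, with Boolean coefficients: as a sum of relations is a
    union, the loop parameter c acts as the identity. *)
Definition free_at a s t := forall j : 'I_n, j != a :> nat -> s j = t j.
Definition glued_at b s t :=
  s = t /\ forall i j : 'I_n, i = b :> nat -> j = b.+1 :> nat -> s i = s j.
(** The generator h^k is attached to the site i if k = 2i+1, and to the bond
    {i, i+1} if k = 2i+2. *)
Definition site_rel k := if odd k then free_at k./2 else glued_at k./2.-1.
Definition letter_rel (x : tlgen N) s t :=
  if x is Some k then site_rel (val k) s t else s = t.
Fixpoint word_rel (u : seq (tlgen N)) s t :=
  if u is x :: u' then exists2 r, letter_rel x s r & word_rel u' r t else s = t.

Lemma word_rel_cat u v s t :
  word_rel (u ++ v) s t <-> exists2 r, word_rel u s r & word_rel v r t.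
Proof.
elim: u s => [|x u IHu] s /=.
  by split=> [vst|[_ <-]]; [exists s|].
split=> [[r xsr /IHu[r' ur vr']]|[r' [r xsr ur] vr']].
  by exists r' => //; exists r.
by exists r => //; apply/IHu; exists r'.
Qed.

Lemma free_update a (i : 'I_n) (x : 'I_n) s : i = a :> nat ->
  free_at a s [ffun j => if j == i then x else s j].
Proof.
by move=> ia j ja; rewrite ffunE; case: eqP => // ji; rewrite ji ia eqxx in ja.
Qed.

(** From right to left, the spin at a is first given the value of the other site
    o of the bond {b, b+1}, so that the bond condition holds, and then the value
    required by t. *)
Lemma free_glued_free a b s t : (a < n)%N -> (b.+1 < n)%N ->
  (a == b) || (a == b.+1) ->
  (exists2 r, free_at a s r & exists2 r', glued_at b r r' & free_at a r' t) <->
  free_at a s t.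
Proof.
move=> aN bN ab; split=> [[r sr [_ [<- _] rt]] j ja|st].
  by rewrite sr ?rt.
have oN : ((if a == b then b.+1 else b) < n)%N by case: ifP; lia.
pose o := Ordinal oN; have oa : o != a :> nat by rewrite /=; case: ifP; lia.
pose r := [ffun j => if j == Ordinal aN then s o else s j].
have sr : free_at a s r by apply: free_update.
exists r => //; exists r; last first.
  by move=> j ja; rewrite -sr ?st.
split=> // i j ib jb; rewrite !ffunE.
have [ia|ia] := eqVneq i (Ordinal aN);
  have [ja|ja] := eqVneq j (Ordinal aN) => //.
- congr (s _); apply: val_inj => /=; move: ia => /(congr1 val) /=.
  by case: ifP; lia.
- congr (s _); apply: val_inj => /=; move: ja => /(congr1 val) /=.
  by case: ifP; lia.
have {}ia : i != a :> nat := ia; have {}ja : j != a :> nat := ja.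
exfalso; lia.
Qed.

(** The other site o of the bond keeps its spin when the one at a is changed, and
    the bond condition after the change restores the spin at a. *)
Lemma glued_free_glued a b s t : (a < n)%N -> (b.+1 < n)%N ->
  (a == b) || (a == b.+1) ->
  (exists2 r, glued_at b s r & exists2 r', free_at a r r' & glued_at b r' t) <->
  glued_at b s t.
Proof.
move=> aN bN ab; split=> [[_ [<- sb] [r sr [<- rb]]]|[<- sb]]; last first.
  by exists s => //; exists s.
split=> //; apply/ffunP => j; have [ja|/sr //] := eqVneq (nat_of_ord j) a.
have oN : ((if a == b then b.+1 else b) < n)%N by case: ifP; lia.
pose o := Ordinal oN; have oa : o != a :> nat by rewrite /=; case: ifP; lia.
suff E (u : spins) :
    (forall i k : 'I_n, i = b :> nat -> k = b.+1 :> nat -> u i = u k) ->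
    u j = u o.
  by rewrite (E s) // (E r) // sr.
move=> ub; case/orP: ab => /eqP ab.
  by apply: ub; rewrite /= ?ab ?eqxx // ja ab.
by symmetry; apply: ub; rewrite /= ?ja // ab; case: eqP => //; lia.
Qed.

(** For two free sites, the change at the site of l is made first; a bond is not
    affected by a change at a site which does not belong to it. *)
Lemma site_rel_comm k l s t : (0 < k)%N -> (0 < l)%N ->
    (k.+1 < l)%N || (l.+1 < k)%N ->
    (exists2 r, site_rel k s r & site_rel l r t) ->
  exists2 r, site_rel l s r & site_rel k r t.
Proof.
rewrite /site_rel => k0 l0 kl.
case: ifP => ko; case: ifP => lo [r].
- move=> sr rt; exists [ffun j : 'I_n => if j == l./2 :> nat then t j else s j].
    by move=> j jl; rewrite ffunE (negPf jl).
  move=> j jk; rewrite ffunE; case: ifP => // /negbT jl.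
  by rewrite sr ?rt.
- move=> sr [<- rb]; exists s => //; split=> // i j ib jb.
  by rewrite !sr; [apply: rb | lia | lia].
- move=> [<- sb] st; exists t => //; split=> // i j ib jb.
  by rewrite -!st; [apply: sb | lia | lia].
by move=> [<- sb] [<- sl]; exists s; split.
Qed.

Lemma site_rel_adj k l s t : (0 < k < N)%N -> (0 < l < N)%N ->
    (l == k.+1) || (k == l.+1) ->
  (exists2 r, site_rel k s r & exists2 r', site_rel l r r' & site_rel k r' t) <->
  site_rel k s t.
Proof.
move=> kN lN kl; rewrite /site_rel.
have -> : odd l = ~~ odd k by lia.
by case: ifP => ko /=; [apply: free_glued_free | apply: glued_free_glued]; lia.
Qed.

Lemma site_rel_idem k s t : 
  (exists2 r, site_rel k s r & site_rel k r t) <-> site_rel k s t.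
Proof.
rewrite /site_rel; case: ifP => _; split=> [[r sr rt]|st].
- by move=> j jk; rewrite sr ?rt.
- by exists s.
- by case: sr => -> _.
by case: st => <- sb; exists s.
Qed.

Lemma word_rel_cong u v : gen_cong (@tl_rel N) u v ->
  forall s t, word_rel u s t <-> word_rel v s t.
Proof.
have w1 x s t : word_rel [:: x] s t <-> letter_rel x s t.
  by split=> [[_ xsr <-]|xst] //; exists t.
have w2 x y s t : word_rel [:: x; y] s t <->
    exists2 r, letter_rel x s r & letter_rel y r t.
  by split=> [[r xr /w1 yr]|[r xr yr]]; exists r => //; apply/w1.
have adj i j s t : (val j == (val i).+1) || (val i == (val j).+1) ->
    word_rel [:: Some i; Some j; Some i] s t <-> word_rel [:: Some i] s t.
  move=> ij; rewrite w1; apply: iff_trans (site_rel_adj s t (valP i) (valP j) ij).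
  by split=> -[r ir jr]; exists r => //; apply/(w2 (Some j) (Some i)).
elim=> {u v} [u v uv|u|u v _ IH|u v w _ IH1 _ IH2|u u' v v' _ IH1 _ IH2] s t.
- case: uv => {u v} [i j ij|i j ij|i j ij|i|i].
  + have [i0 _] := andP (valP i); have [j0 _] := andP (valP j).
    by split=> /w2 /site_rel_comm H; apply/w2/H => //; rewrite ij ?orbT.
  + by apply: adj; rewrite ij eqxx.
  + by apply: adj; rewrite ij eqxx orbT.
  + split=> /w2 [r ir jr]; apply/w2.
      by exists s => //=; rewrite -jr.
    by exists t => //=; rewrite ir.
  rewrite w2 site_rel_idem; split=> [ist|/w2 [_ <-] //].
  by apply/w2; exists s.
- by [].
- by rewrite IH.
- by rewrite IH1.
by split=> /word_rel_cat [r /IH1 ? /IH2 ?]; apply/word_rel_cat; exists r.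
Qed.

Definition mon_rel (x : tlmon N) s t := word_rel (repr x) s t.

Lemma mon_rel_word u s t : mon_rel (word (@tl_rel N) u) s t <-> word_rel u s t.
Proof.
by apply: word_rel_cong; apply/eq_word; rewrite /word reprK.
Qed.

Lemma mon_relM x y s t :
  mon_rel (x * y) s t <-> exists2 r, mon_rel x s r & mon_rel y r t.
Proof.
elim/presentedW: x => u; elim/presentedW: y => v.
rewrite wordM mon_rel_word word_rel_cat.
by split=> -[r ur vr]; exists r; apply/mon_rel_word.
Qed.

Lemma mon_rel_tlh k s t : (0 < k < N)%N ->
  mon_rel (tlh N k) s t <-> site_rel k s t.
Proof.
move=> kN; rewrite tlhE mon_rel_word.
by split=> [[_ xsr <-]|xst] //; exists t.
Qed.

Lemma site_rel_free1 i : site_rel (2 * i + 1) = free_at i.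
Proof.
rewrite /site_rel (_ : odd _ = true); last by lia.
by congr free_at; lia.
Qed.

Lemma site_rel_free3 i : site_rel (2 * i + 3) = free_at i.+1.
Proof. by rewrite -site_rel_free1; congr site_rel; lia. Qed.

Lemma site_rel_glued i : site_rel (2 * i + 2) = glued_at i.
Proof.
rewrite /site_rel (_ : odd _ = false); last by lia.
by congr glued_at; lia.
Qed.

Definition pull (g : ordmon n) s : spins := [ffun j => s (g j)].

Lemma pull1 s : pull 1 s = s.
Proof. by apply/ffunP => j; rewrite ffunE ordmon_oneE. Qed.

Lemma pullM f g s : pull (f * g) s = pull g (pull f s).
Proof. by apply/ffunP => j; rewrite [LHS]ffunE ordmon_mulE [RHS]ffunE ffunE. Qed.

Lemma mon_rel_p i s t : (i.+1 < n)%N ->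
  mon_rel (tl_p (tlh N) i) s t <-> t = pull (pgen n i) s.
Proof.
move=> iN; have iN' := ltnW iN.
rewrite mon_relM; split.
  case=> r /mon_rel_tlh sr /mon_rel_tlh rt.
  move: (sr ltac:(lia)) (rt ltac:(lia)) => {sr rt}.
  rewrite site_rel_free3 site_rel_glued.
  move=> sr [<- rb]; apply/ffunP => j; rewrite !ffunE.
  have [ji|ji] := eqVneq (nat_of_ord j) i.+1.
    rewrite -(rb (Ordinal iN')) /= ?ji; [|lia|lia].
    rewrite sr; last by rewrite pfunE ji eqxx; lia.
    by congr (r _); apply: val_inj; rewrite /= pfunE ji eqxx.
  have E : pfun i j = j by apply: val_inj; rewrite /= pfunE (negPf ji).
  by rewrite E sr.
move=> ->; exists (pull (pgen n i) s); apply/mon_rel_tlh; try lia.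
  rewrite site_rel_free3.
  move=> j ji; rewrite !ffunE; congr (s _); apply: val_inj.
  by rewrite /= pfunE (negPf ji).
rewrite site_rel_glued.
split=> // j k ji ki; rewrite !ffunE; congr (s _); apply: val_inj.
by rewrite /= !pfunE; do 2 case: eqP; lia.
Qed.

Lemma mon_rel_q i s t : (i.+1 < n)%N ->
  mon_rel (tl_q (tlh N) i) s t <-> t = pull (qgen n i) s.
Proof.
move=> iN; have iN' := ltnW iN.
rewrite mon_relM; split.
  case=> r /mon_rel_tlh sr /mon_rel_tlh rt.
  move: (sr ltac:(lia)) (rt ltac:(lia)) => {sr rt}.
  rewrite site_rel_free1 site_rel_glued.
  move=> sr [<- rb]; apply/ffunP => j; rewrite !ffunE.
  have [ji|ji] := eqVneq (nat_of_ord j) i.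
    rewrite (rb _ (Ordinal iN)) /= ?ji; [|lia|lia].
    rewrite sr; last by rewrite qfunE ji eqxx iN /=; lia.
    by congr (r _); apply: val_inj; rewrite /= qfunE ji eqxx iN.
  have E : qfun i j = j by apply: val_inj; rewrite /= qfunE (negPf ji).
  by rewrite E sr.
move=> ->; exists (pull (qgen n i) s); apply/mon_rel_tlh; try lia.
  rewrite site_rel_free1.
  move=> j ji; rewrite !ffunE; congr (s _); apply: val_inj.
  by rewrite /= qfunE (negPf ji).
rewrite site_rel_glued.
split=> // j k ji ki; rewrite !ffunE; congr (s _); apply: val_inj.
by rewrite /= !qfunE iN !andbT; do 2 case: eqP; lia.
Qed.

End Spins.

(** * The embedding *)

Section Embedding.
Variable n : nat.
Local Notation h := (tlh (2 * n)).

Let pP := tl_p_catalan (@tlh_adj n) (@tlh_far n).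
Let qP := tl_q_catalan (@tlh_adj n) (@tlh_far n).
Let pq_same := tl_pq_same (@tlh_adj n).
Let qp_same := tl_qp_same (@tlh_adj n).
Let pq_next := tl_pq_next (@tlh_adj n).
Let qp_next := tl_qp_next (@tlh_adj n).
Let pq_comm := tl_pq_comm (@tlh_far n).

Definition embed : ordmon n -> tlmon (2 * n) := lift (tl_p h) (tl_q h).

Lemma embed_pgen g i : (i.+1 < n)%N ->
  embed (g * pgen n i) = embed g * tl_p h i.
Proof. exact: (lift_pgen pP qP qp_same qp_next). Qed.

Lemma embed_qgen g i : (i.+1 < n)%N ->
  embed (g * qgen n i) = embed g * tl_q h i.
Proof. exact: (lift_qgen pP qP pq_same qp_same pq_next qp_next pq_comm). Qed.

Lemma embed1 : embed 1 = 1.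
Proof. exact: lift1. Qed.

Lemma embed_morphism : monoid_morphism embed.
Proof.
exact: (lift_morphism pP qP pq_same qp_same pq_next qp_next pq_comm).
Qed.

Lemma mon_rel_embed g s t : mon_rel (embed g) s t <-> t = pull g s.
Proof.
elim/ordmon_ind: g s t => [|g i iN IHg|g i iN IHg] s t.
- by rewrite embed1 (mon_rel_word [::]) pull1; split=> ->.
- rewrite embed_pgen // mon_relM pullM.
  split=> [[_ /IHg-> /mon_rel_p->]|->] //.
  by exists (pull g s); [apply/IHg | apply/mon_rel_p].
- rewrite embed_qgen // mon_relM pullM.
  split=> [[_ /IHg-> /mon_rel_q->]|->] //.
  by exists (pull g s); [apply/IHg | apply/mon_rel_q].
Qed.

Lemma embed_inj : injective embed.
Proof.
move=> f g fg; have : mon_rel (embed g) [ffun j => j] (pull f [ffun j => j]).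
  by rewrite -fg; apply/mon_rel_embed.
move/mon_rel_embed/ffunP => E; apply: ordmon_ext => j.
by have := E j; rewrite !ffunE.
Qed.

End Embedding.

Theorem mainTheorem14 (n : nat) :
  exists f : ordmon n -> tlmon (2 * n),
    [/\ monoid_morphism f, injective f &
        forall i : nat, (i.+1 < n)%N ->
          f (pgen n i) = tlh (2 * n) (2 * i + 3) * tlh (2 * n) (2 * i + 2) /\
          f (qgen n i) = tlh (2 * n) (2 * i + 1) * tlh (2 * n) (2 * i + 2)].
Proof.
exists (@embed n); split; [exact: embed_morphism | exact: embed_inj |].
move=> i iN; split.
  by rewrite -[pgen n i]mul1g embed_pgen // embed1 mul1g.
by rewrite -[qgen n i]mul1g embed_qgen // embed1 mul1g.
Qed.
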